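(* There is an absolute constant $c>0$ such that for every prime $p$ and every symmetric set $A \subset \mathbb{Z}/p\mathbb{Z}$ with $|A| = (p+1)/2$ we have $$M_{\mathbb{Z}/p\mathbb{Z}}(A) \geq c\,p^{c}.$$
   Context: A subset $A$ of an abelian group $G$ is symmetric if $-x\in A$ whenever $x \in A$. For a finite symmetric subset $A$ of a (discrete) abelian group $G$, let $\widehat{G}$ be the group of homomorphisms $\gamma: G \to S^1=\{z \in \mathbb{C}:|z|=1\}$, let $\widehat{1_A}(\gamma) = \sum_{x \in A}\overline{\gamma(x)}$ (which is real because $A$ is symmetric), and define $M_G(A) := \sup_{\gamma \in \widehat{G}} -\widehat{1_A}(\gamma)$. *)

(* Defs.v *)
From HB Require Import structures.
From mathcomp Require Import all_boot all_order all_algebra finmap.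
From mathcomp Require Import all_classical all_reals all_analysis.
From mathcomp Require Import complex.

Set Implicit Arguments.
Unset Strict Implicit.
Unset Printing Implicit Defensive.

Import Order.TTheory GRing.Theory Num.Theory.

Local Open Scope classical_set_scope.
Local Open Scope ring_scope.

Definition symmetric_fset (G : zmodType) (A : {fset G}) : Prop :=
  forall x : G, x \in A -> - x \in A.

(* The norm of R[i] takes its values in R[i] itself, so that `|z| = 1 says
   that z lies on the unit circle. *)
Definition dual_group (R : realType) (G : zmodType) : set (G -> R[i]) :=
  [set gamma : G -> R[i] |
    (forall x y : G, gamma (x + y) = gamma x * gamma y) /\
    (forall x : G, `|gamma x| = 1)].

Definition fourier_indicator (R : realType) (G : zmodType) (A : {fset G})
    (gamma : G -> R[i]) : R[i] :=
  \sum_(x <- A) ((gamma x)^*)%C.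

(* For symmetric A the transform is real, so that taking its real part loses
   nothing; the set below contains - #|A| (trivial character) and is bounded
   above by #|A|, so that sup is a genuine least upper bound. *)
Definition M_sup (R : realType) (G : zmodType) (A : {fset G}) : R :=
  sup [set - complex.Re (fourier_indicator A gamma)
        | gamma in @dual_group R G].

(* Main.v *)
(* Let g = 1_A + M delta_0 and K = g(0), so that K is M or M + 1 and h, the
   Fourier transform of g, is nonnegative. As 1_A is idempotent,
   g^2 = g + (K^2 - K) delta_0, which on the dual side reads
     \sum_j h(j) h(k - j) = p (h(k) + K^2 - K).
   The density of A gives 2 h(0) >= p, so for k <> 0 the terms j = 0 and j = k
   on the left already absorb p h(k); every other term is then at most p K M,
   and k = 2j gives h(j)^2 <= p K M for j <> 0. On the other hand
   \sum_j h(j) = p K while \sum_(j <> 0) h(j)^2 is of order p^2, which forces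
   p = O((M + 1)^3 M). *)
Require Import Defs.
From mathcomp Require Import all_boot all_order all_algebra finmap.
From mathcomp Require Import all_classical all_reals all_analysis.
From mathcomp Require Import complex.
From mathcomp Require Import ring lra zify.

Import Order.TTheory GRing.Theory Num.Theory.

Local Open Scope ring_scope.

(** For [x != 0], multiplication by [x] permutes the field. Hence one character [e] with vanishing
    sum gives the whole family [e (k * x)], indexed by [k] in [F], with its orthogonality. *)
Lemma sum_additive_character (F : finFieldType) (C : numFieldType) (e : F -> C) :
    e 0 = 1 -> \sum_x e x = 0 ->
  forall x : F, \sum_k e (k * x) = if x == 0 then #|F|%:R else 0.
Proof.
move=> e1 e0 x; have [->|x0] := eqVneq x 0.
  by under eq_bigr do rewrite mulr0; rewrite e1 sumr_const.
by rewrite -[RHS]e0 [RHS](reindex_inj (mulIf x0)).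
Qed.

Lemma sum_fourier (F : finFieldType) (C : numFieldType) (e : F -> C) (g : F -> C) :
    (forall x : F, \sum_k e (k * x) = if x == 0 then #|F|%:R else 0) ->
  \sum_k \sum_x g x * e (k * x) = #|F|%:R * g 0.
Proof.
move=> eS; rewrite exchange_big /= (bigD1 0) //= -mulr_sumr eS eqxx mulrC.
rewrite big1 ?addr0 // => x /negPf x0.
by rewrite -mulr_sumr eS x0 mulr0.
Qed.

Lemma convolution_fourier (F : finFieldType) (C : numFieldType)
    (e : F -> C) (g : F -> C) :
    {morph e : x y / x + y >-> x * y} ->
    (forall x : F, \sum_k e (k * x) = if x == 0 then #|F|%:R else 0) ->
  forall k, \sum_j (\sum_x g x * e (j * x)) * (\sum_x g x * e ((k - j) * x)) =
    #|F|%:R * \sum_x g x ^+ 2 * e (k * x).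
Proof.
move=> eD eS k.
transitivity (\sum_j \sum_x \sum_y g x * g y * e (k * y) * e (j * (x - y))).
  apply: eq_bigr => j _; rewrite mulr_suml; apply: eq_bigr => x _.
  rewrite mulr_sumr; apply: eq_bigr => y _.
  rewrite -!mulrA; congr (_ * _); rewrite mulrCA; congr (_ * _).
  by rewrite -!eD; congr e; ring.
rewrite exchange_big mulr_sumr; apply: eq_bigr => x _ /=.
rewrite exchange_big (bigD1 x) //= -mulr_sumr eS subrr eqxx.
rewrite big1 ?addr0 => [|y yx]; first by ring.
by rewrite -mulr_sumr eS subr_eq0 eq_sym (negPf yx) mulr0.
Qed.

Lemma sum_sq_nonzero_le (R : rcfType) (F : finFieldType) (h : F -> R) (K M : R) :
    (forall x : F, x + x = 0 -> x = 0) ->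
    (forall k, 0 <= h k) -> 0 <= M -> 0 <= K -> K <= M + 1 ->
    #|F|%:R <= 2 * h 0 -> \sum_k h k = #|F|%:R * K ->
    (forall k, \sum_j h j * h (k - j) = #|F|%:R * (h k + (K ^+ 2 - K))) ->
  (\sum_(k | k != 0) h k ^+ 2) ^+ 2 <= #|F|%:R ^+ 3 * K ^+ 3 * M.
Proof.
move=> F2 h0 M0 K0 KM hS sumh conv.
set P : R := #|F|%:R in hS sumh conv *.
have P0 : 0 <= P by rewrite ler0n.
have hB j : j != 0 -> h j ^+ 2 <= P * K * M.
  (* In odd characteristic [0], [j + j] and [j] are distinct, so these three terms can be split off
     the convolution at [j + j]. *)
  move=> j0; have jj0 : j + j != 0 by apply: contraNneq j0 => /F2 ->.
  have jjj : j + j != j by rewrite -subr_eq0 addrK.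
  have := conv (j + j).
  rewrite (bigD1 0) //= (bigD1 (j + j)) //= (bigD1 j) /=; last by rewrite j0 eq_sym.
  rewrite subr0 subrr addrK.
  set s := \sum_(_ | _) _.
  have s0 : 0 <= s by apply: sumr_ge0 => i _; rewrite mulr_ge0.
  have h1 : 0 <= (2 * h 0 - P) * h (j + j) by rewrite mulr_ge0 // subr_ge0.
  have h2 : 0 <= P * K * (M + 1 - K) by rewrite !mulr_ge0 // subr_ge0.
  (* Dropping [s] and [h1] leaves [h j ^+ 2 <= P * (K ^+ 2 - K)], and [h2] replaces [K - 1] by
     [M]. *)
  by nra.
set B := Num.sqrt (P * K * M).
have PKM0 : 0 <= P * K * M by rewrite !mulr_ge0.
have B2 : B ^+ 2 = P * K * M by rewrite sqr_sqrtr.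
have T0 : 0 <= \sum_(k | k != 0) h k ^+ 2 by apply: sumr_ge0 => i _; rewrite sqr_ge0.
(* The sum of squares is at most the maximum times the sum. *)
have : \sum_(k | k != 0) h k ^+ 2 <= B * (P * K).
  rewrite -sumh [X in B * X](bigD1 0) //= mulrDr mulr_sumr.
  apply: (@le_trans _ _ (\sum_(k | k != 0) B * h k)).
    apply: ler_sum => k k0; rewrite expr2 ler_wpM2r //.
    by rewrite -(ler_pXn2r (ltn0Sn 1)) ?nnegrE ?sqrtr_ge0 // B2 hB.
  by rewrite lerDr mulr_ge0 ?sqrtr_ge0.
move=> TB; have -> : P ^+ 3 * K ^+ 3 * M = (B * (P * K)) ^+ 2.
  by rewrite exprMn B2; ring.
by rewrite ler_pXn2r ?nnegrE // mulr_ge0 ?sqrtr_ge0 // mulr_ge0.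
Qed.

Lemma exists_additive_character (C : numClosedFieldType) (p : nat) : prime p ->
  exists e : 'F_p -> C, [/\ {morph e : x y / x + y >-> x * y},
    e 0 = 1, (forall x, `|e x| = 1) & \sum_x e x = 0].
Proof.
move=> pr_p.
(* A root of 1 + X + ... + X^(p-1) has the vanishing sum built in, and the geometric sum identity
   then gives [w ^+ p = 1]. *)
have [w rw] : exists w : C, root (\poly_(i < p) 1) w.
  apply/closed_rootP; rewrite size_poly_eq ?oner_neq0 //.
  by rewrite neq_ltn prime_gt1 ?orbT.
have ws : \sum_(i < p) w ^+ i = 0.
  move/eqP: rw; rewrite horner_poly => rw; rewrite -[RHS]rw.
  by apply: eq_bigr => i _; rewrite mul1r.
have wp : w ^+ p = 1 by apply/eqP; rewrite -subr_eq0 subrX1 ws mulr0.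
have w1 : `|w| = 1.
  apply/eqP; rewrite -(@pexpr_eq1 _ _ p) ?prime_gt0 //.
  by rewrite -normrX wp normr1.
exists (fun x => w ^+ x); split.
- by move=> x y; rewrite -exprD; apply: expr_mod; rewrite Fp_cast.
- by rewrite expr0.
- by move=> x; rewrite normrX w1 expr1n.
- by rewrite -[RHS]ws -[in RHS](Fp_cast pr_p).
Qed.

(** Conjugation turns [e x] into [e (- x)], and the substitution x -> -x preserves [A]; so the
    conjugate may be dropped and the sum is real. *)
Lemma fourier_indicatorE (R : realType) (F : finFieldType) (A : {fset F})
    (e : F -> R[i]) :
    {morph e : x y / x + y >-> x * y} -> e 0 = 1 -> (forall x, `|e x| = 1) ->
    symmetric_fset A ->
  forall k, (complex.Re (fourier_indicator A (fun x => e (k * x))))%:C%C =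
    \sum_x (x \in A)%:R * e (k * x).
Proof.
move=> eD e0 e1 symA k.
have conje x : ((e x)^*)%C = e (- x).
  have ex0 : e x != 0 by rewrite -normr_eq0 e1 oner_neq0.
  by apply: (mulfI ex0); rewrite -eD subrr e0 -sqr_normc e1 expr1n.
have fA (f : F -> R[i]) : \sum_(x <- A) f x = \sum_x (x \in A)%:R * f x.
  rewrite big_uniq ?fset_uniq //= big_mkcond /=.
  by apply: eq_bigr => x _; case: ifP; rewrite ?mul1r ?mul0r.
have E : fourier_indicator A (fun x => e (k * x)) =
    \sum_x (x \in A)%:R * e (k * x).
  rewrite /fourier_indicator fA (reindex_inj oppr_inj) /=.
  apply: eq_bigr => x _; rewrite conje mulrN opprK; congr (_%:R * _).
  by congr nat_of_bool; apply/idP/idP => /symA; rewrite ?opprK.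
rewrite RRe_real // CrealE; apply/eqP; rewrite [RHS]E -fA.
by rewrite rmorph_sum; apply: eq_bigr => x _; exact: conjcK.
Qed.

Lemma dichotomy_arithmetic (R : realFieldType) (P M T : R) (b : bool) :
    3 <= P -> 0 <= M ->
    let K := M + b%:R in
    ((P + 1) / 2 + M) * ((P + 1) / 2 + M) + T =
      P * ((P + 1) / 2 + M + (K ^+ 2 - K)) ->
    T ^+ 2 <= P ^+ 3 * K ^+ 3 * M ->
  P <= 648 * M \/ P <= 648 * M ^+ 4.
Proof.
move=> P3 M0 K eT Tle.
have [K0 KM] : 0 <= K /\ K <= M + 1.
  by rewrite /K; case: (b) => /=; split; lra.
(* If [M] is at least (P-1)/8 the linear alternative holds at once. Otherwise the main term
   (P^2-1)/4 of [T] dominates, even when [K ^+ 2 - K] is negative. *)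
have [Mbig|Msmall] := leP (P - 1) (8 * M); first by left; lra.
have T1 : P ^+ 2 <= 9 * T.
  have : T = (P ^+ 2 - 1) / 4 - M - M ^+ 2 + P * (K ^+ 2 - K) by nra.
  by rewrite /K; case: b {K KM K0 Tle eT} => /=; nra.
have P81 : P <= 81 * ((M + 1) ^+ 3 * M).
  have : P ^+ 3 * P <= P ^+ 3 * (81 * ((M + 1) ^+ 3 * M)).
    have KM3 : K ^+ 3 <= (M + 1) ^+ 3 by rewrite lerXn2r ?nnegrE //; lra.
    apply: (@le_trans _ _ (81 * T ^+ 2)).
      have -> : P ^+ 3 * P = (P ^+ 2) ^+ 2 by ring.
      have -> : 81 * T ^+ 2 = (9 * T) ^+ 2 by ring.
      by rewrite lerXn2r ?nnegrE ?sqr_ge0 // (le_trans _ T1) ?sqr_ge0.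
    apply: (@le_trans _ _ (81 * (P ^+ 3 * K ^+ 3 * M))); first by rewrite ler_pM2l.
    have -> : P ^+ 3 * (81 * ((M + 1) ^+ 3 * M)) = 81 * (P ^+ 3 * (M + 1) ^+ 3 * M) by ring.
    rewrite ler_pM2l // ler_wpM2r // ler_wpM2l // exprn_ge0 //; lra.
  have P30 : 0 < P ^+ 3 by rewrite exprn_gt0 //; lra.
  by rewrite (ler_pM2l P30).
(* The constant is 648 = 81 * 2^3: [M + 1] is at most 2 in the first case and at most [2 * M] in the
   second. *)
have [M1|/ltW M1] := leP M 1.
  have : (M + 1) ^+ 3 <= 2 ^+ 3 by rewrite lerXn2r ?nnegrE //; lra.
  by left; nra.
have : (M + 1) ^+ 3 <= (2 * M) ^+ 3 by rewrite lerXn2r ?nnegrE //; lra.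
by rewrite exprMn => H; right; nra.
Qed.

Lemma spectral_dichotomy (R : realType) (F : finFieldType) (e : F -> R[i])
    (A : {fset F}) (M : R) :
    {morph e : x y / x + y >-> x * y} -> e 0 = 1 -> (forall x, `|e x| = 1) ->
    \sum_x e x = 0 -> (2%:R != 0 :> F) ->
    symmetric_fset A -> (2 * #|` A|)%N = #|F|.+1 -> 0 <= M ->
    (forall gamma, @dual_group R _ gamma ->
      - complex.Re (fourier_indicator A gamma) <= M) ->
  #|F|%:R <= 648 * M \/ #|F|%:R <= 648 * M ^+ 4.
Proof.
move=> eD e0 e1 es F2 symA cardA M0 hM.
have eS := @sum_additive_character _ _ e e0 es.
have fE := @fourier_indicatorE R F A e eD e0 e1 symA.
pose h k : R := complex.Re (fourier_indicator A (fun x => e (k * x))) + M.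
pose K : R := M + (0 \in A)%:R.
pose g x : R[i] := (x \in A)%:R + M%:C%C * (x == 0)%:R.
have hE k : (h k)%:C%C = \sum_x g x * e (k * x).
  rewrite /h rmorphD /= fE.
  under [RHS]eq_bigr do rewrite mulrDl.
  rewrite big_split /=; congr (_ + _); rewrite (bigD1 0) //= eqxx mulr0 e0 !mulr1.
  by rewrite big1 ?addr0 // => x /negPf->; rewrite mulr0 mul0r.
have g0 : g 0 = K%:C%C by rewrite /g eqxx mulr1 addrC rmorphD rmorph_nat.
have sumh : \sum_k h k = #|F|%:R * K.
  apply: (@complexI R); rewrite rmorph_sum rmorphM rmorph_nat /= -g0.
  by rewrite -(sum_fourier F _ e g eS); apply: eq_bigr => k _.
have conv k : \sum_j h j * h (k - j) = #|F|%:R * (h k + (K ^+ 2 - K)).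
  apply: (@complexI R); rewrite rmorph_sum rmorphM rmorph_nat /=.
  transitivity (#|F|%:R * \sum_x g x ^+ 2 * e (k * x)).
    rewrite -(convolution_fourier F _ e g eD eS); apply: eq_bigr => j _.
    by rewrite rmorphM /= !hE.
  congr (_ * _); rewrite rmorphD /= hE (bigD1 0) //= [in RHS](bigD1 0) //=.
  rewrite mulr0 e0 !mulr1 g0 rmorphB rmorphXn /=.
  have -> : \sum_(x | x != 0) g x ^+ 2 * e (k * x) =
            \sum_(x | x != 0) g x * e (k * x).
    apply: eq_bigr => x /negPf x0; rewrite /g x0 mulr0 addr0.
    by case: (x \in A); rewrite ?expr1n ?expr0n.
  by ring.
have hpos k : 0 <= h k.
  rewrite -lerBlDr sub0r lerNl; apply: hM; split=> [x y|x]; last exact: e1.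
  by rewrite mulrDr eD.
have h0 : h 0 = (#|F|%:R + 1) / 2 + M.
  congr (_ + _); apply: (@complexI R); rewrite fE.
  under eq_bigr do rewrite mul0r e0 mulr1.
  rewrite -natr_sum.
  have -> : (\sum_(x : F) (x \in A) = #|` A|)%N.
    rewrite -(card_uniqP (fset_uniq A)) -sum1_card [RHS]big_mkcond /=.
    by apply: eq_bigr => x _; case: (x \in A).
  have -> : (#|F|%:R + 1) / 2 = #|` A|%:R :> R.
    by rewrite -[1]/(1%:R) -natrD addn1 -cardA natrM; field.
  by rewrite rmorph_nat.
have [K0 KM] : 0 <= K /\ K <= M + 1.
  by rewrite /K; case: (0 \in A) => /=; split; lra.
(* By [cardA] the order of [F] is odd, and it exceeds 1. *)
have p3R : 3 <= #|F|%:R :> R.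
  have F1 : (1 < #|F|)%N := card_finNzRing_gt1 F.
  by rewrite ler_nat; move: #|F| #|` A| F1 cardA => n a; lia.
have xx0 (x : F) : x + x = 0 -> x = 0.
  rewrite -mulr2n -mulr_natr => /eqP.
  by rewrite mulf_eq0 (negPf F2) orbF => /eqP.
have hS : #|F|%:R <= 2 * h 0 by rewrite h0; lra.
have := @sum_sq_nonzero_le R _ h K M xx0 hpos M0 K0 KM hS sumh conv.
have := conv 0; rewrite (bigD1 0) //= subr0.
(* Symmetry of [A] makes [h] even, so the convolution at 0 is a sum of squares. *)
have -> : \sum_(j | j != 0) h j * h (0 - j) = \sum_(j | j != 0) h j ^+ 2.
  apply: eq_bigr => j _; rewrite sub0r expr2; congr (_ * _).
  congr (_ + _); apply: (@complexI R); rewrite !fE.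
  rewrite (reindex_inj oppr_inj) /=; apply: eq_bigr => x _.
  rewrite mulrNN; congr (_%:R * _).
  by congr nat_of_bool; apply/idP/idP => /symA; rewrite ?opprK.
set T := \sum_(_ | _) _; rewrite h0.
have := @dichotomy_arithmetic R #|F|%:R M T (0 \in A) p3R M0.
by rewrite -/K => H eT TM; apply: H.
Qed.

(** The triangle inequality bounds every value by the size of [A], so [sup] does not fall back on
    its default value. *)
Lemma M_sup_ub (R : realType) (G : zmodType) (A : {fset G}) (gamma : G -> R[i]) :
  dual_group gamma -> - complex.Re (fourier_indicator A gamma) <= M_sup R A.
Proof.
move=> dg; apply: ub_le_sup; last by exists gamma.
exists (#|` A|%:R) => _ [f [_ f1] <-].
rewrite (le_trans (ler_norm _)) // normrN -lecR (le_trans (normc_ge_Re _)) //.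
rewrite (le_trans (ler_norm_sum _ _ _)) // rmorph_nat.
rewrite big_seq (eq_bigr (fun=> 1)) => [|x _]; last by rewrite normcJ f1.
by rewrite -big_seq big_const_seq count_predT iter_addr_0.
Qed.

(** Since [1 <= B], the quartic alternative gives P <= (B M)^4; since [1 <= P], lowering the
    exponent to [c] only helps. *)
Lemma powR_le_of_dichotomy (R : realType) (P M B c : R) :
    1 <= P -> 0 <= M -> 1 <= B -> c <= 4^-1 ->
    P <= B * M \/ P <= B * M ^+ 4 ->
  P `^ c <= B * M.
Proof.
move=> P1 M0 B1 c4 [PM|PM].
  apply: le_trans PM; rewrite -[leRHS]powRr1; last lra.
  by rewrite ler_powR //; lra.
apply: (@le_trans _ _ (P `^ 4^-1)); first by rewrite ler_powR.
have BM0 : 0 <= B * M by rewrite mulr_ge0 //; lra.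
rewrite -(@ler_pXn2r _ 4) ?nnegrE ?powR_ge0 //.
rewrite -powR_mulrn ?powR_ge0 // -powRrM mulVf // powRr1; last lra.
rewrite exprMn (le_trans PM) // ler_wpM2r ?exprn_ge0 //.
by rewrite ler_eXnr.
Qed.

(* The cardinality is stated without division, so that p = 2, for which
   (p + 1) / 2 is not an integer, is vacuous. *)
Theorem theorem1p2 (R : realType) :
  exists c : R, 0 < c /\
    forall (p : nat) (A : {fset 'F_p}),
      prime p -> symmetric_fset A -> (2 * #|` A|)%N = p.+1 ->
      c * (p%:R `^ c) <= M_sup R A.
Proof.
(* The same number serves as exponent, being at most 1/4, and as the factor that cancels 648. *)
exists 648^-1; split=> [|p A pr_p symA cardA]; first lra.
have p1 : 1 <= p%:R :> R by rewrite ler1n prime_gt0.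
(* The sign of [M_sup R A] is not known yet; the bound [pM] forces [M] to be positive, so the
   maximum is [M_sup R A] itself. *)
pose M := Num.max 0 (M_sup R A).
have M0 : 0 <= M by rewrite le_max lexx.
have pM : p%:R `^ 648^-1 <= 648 * M.
  have [e [eD e0 e1 es]] := @exists_additive_character R[i] p pr_p.
  have cF := card_Fp pr_p.
  have F2 : 2%:R != 0 :> 'F_p.
    rewrite -(dvdn_pcharf (pchar_Fp pr_p)).
    by apply/negP => /(dvdn_leq (ltn0Sn 1)); move: (prime_gt1 pr_p) cardA; lia.
  have hM gamma : @dual_group R _ gamma ->
      - complex.Re (fourier_indicator A gamma) <= M.
    by move=> dg; rewrite le_max M_sup_ub ?orbT.
  have cardAF : (2 * #|` A|)%N = #|'F_p|.+1 by rewrite cF.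
  have := @spectral_dichotomy R 'F_p e A M eD e0 e1 es F2 symA cardAF M0 hM.
  rewrite cF; apply: powR_le_of_dichotomy => //; lra.
have ppos : 0 < p%:R `^ 648^-1 :> R by rewrite powR_gt0 //; lra.
suff -> : M_sup R A = M by lra.
have : 0 < M by lra.
by rewrite /M maxEle; case: ifP => // _; rewrite ltxx.
Qed.
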